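(* Let $n\ge 1$ and let $S\in\{\mathcal{CP}_n,\mathcal{ORCP}_n,\mathcal{OCP}_n\}$. Then on $S$ the relations $\mathcal{D}^*$ and $\mathcal{J}^*$ coincide: $\mathcal{D}^*=\mathcal{J}^*$.
   Context: Let $[n]=\{1,2,\dots,n\}$ with the usual order, and let $\mathcal{P}_n$ be the semigroup of all partial maps $\alpha$ with domain $\operatorname{Dom}\alpha\subseteq[n]$ and image $\operatorname{Im}\alpha\subseteq[n]$ (including the empty map). Maps are written on the right and composed left to right: $x(\alpha\beta)=(x\alpha)\beta$, defined for those $x\in\operatorname{Dom}\alpha$ with $x\alpha\in\operatorname{Dom}\beta$. A map $\alpha\in\mathcal{P}_n$ is a contraction if $|x\alpha-y\alpha|\le|x-y|$ for all $x,y\in\operatorname{Dom}\alpha$; it is order preserving (resp. order reversing) if for all $x,y\in\operatorname{Dom}\alpha$, $x\le y$ implies $x\alpha\le y\alpha$ (resp. $x\alpha\ge y\alpha$). $\mathcal{CP}_n$ is the semigroup of all contractions in $\mathcal{P}_n$; $\mathcal{OCP}_n$ is the subsemigroup of order preserving contractions; $\mathcal{ORCP}_n$ is the subsemigroup of contractions that are order preserving or order reversing. For a semigroup $S$ (with $S^1$ denoting $S$ with an identity adjoined if necessary): $a\,\mathcal{L}^*\,b$ iff for all $x,y\in S^1$, $ax=ay\Leftrightarrow bx=by$; $a\,\mathcal{R}^*\,b$ iff for all $x,y\in S^1$, $xa=ya\Leftrightarrow xb=yb$; $\mathcal{D}^*$ is the join of $\mathcal{L}^*$ and $\mathcal{R}^*$,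 i.e. the smallest equivalence relation containing both. Write $L^*_a$, $R^*_a$ for the $\mathcal{L}^*$- and $\mathcal{R}^*$-class of $a$. A left (resp. right) $*$-ideal of $S$ is a left (resp. right) ideal $I$ of $S$ with $L^*_a\subseteq I$ (resp. $R^*_a\subseteq I$) for all $a\in I$; a $*$-ideal is a subset that is both a left and a right $*$-ideal. $J^*(a)$ is the intersection of all $*$-ideals of $S$ containing $a$, and $a\,\mathcal{J}^*\,b$ iff $J^*(a)=J^*(b)$. *)

(* Defs.v *)
From Stdlib Require Relation_Definitions.
From HB Require Import structures.
From mathcomp Require Import all_boot all_order all_algebra.

Set Implicit Arguments.
Unset Strict Implicit.
Unset Printing Implicit Defensive.

Local Open Scope group_scope.

Section StarRelations.
Variable S : semigroupType.

(* S^1 lives inside [option S]: [Some s] stands for s, and [None] for the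
   adjoined identity, which belongs to S^1 only when S has no identity. *)
Definition has_identity : Prop :=
  exists e : S, forall s : S, e * s = s /\ s * e = s.

Definition in_S1 (x : option S) : Prop :=
  if x is None then ~ has_identity else True.

Definition mulS1r (a : S) (x : option S) : S := if x is Some s then a * s else a.
Definition mulS1l (x : option S) (a : S) : S := if x is Some s then s * a else a.

Definition Lstar (a b : S) : Prop :=
  forall x y : option S, in_S1 x -> in_S1 y ->
    (mulS1r a x = mulS1r a y <-> mulS1r b x = mulS1r b y).

Definition Rstar (a b : S) : Prop :=
  forall x y : option S, in_S1 x -> in_S1 y ->
    (mulS1l x a = mulS1l y a <-> mulS1l x b = mulS1l y b).

Definition Dstar (a b : S) : Prop :=
  forall E : S -> S -> Prop,
    Relation_Definitions.equivalence S E ->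
    Relation_Definitions.inclusion S Lstar E ->
    Relation_Definitions.inclusion S Rstar E ->
    E a b.

Definition left_ideal (I : S -> Prop) : Prop := forall s a : S, I a -> I (s * a).
Definition right_ideal (I : S -> Prop) : Prop := forall s a : S, I a -> I (a * s).

Definition left_star_ideal (I : S -> Prop) : Prop :=
  left_ideal I /\ forall a b : S, I a -> Lstar a b -> I b.
Definition right_star_ideal (I : S -> Prop) : Prop :=
  right_ideal I /\ forall a b : S, I a -> Rstar a b -> I b.
Definition star_ideal (I : S -> Prop) : Prop :=
  left_star_ideal I /\ right_star_ideal I.

Definition principal_star_ideal (a : S) : S -> Prop :=
  fun x => forall I : S -> Prop, star_ideal I -> I a -> I x.

Definition Jstar (a b : S) : Prop :=
  forall x : S, principal_star_ideal a x <-> principal_star_ideal b x.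

End StarRelations.

(* The chain [n] is represented by 'I_n, that is {0, ..., n-1} in place of
   {1, ..., n}; [a x = None] means that x is outside the domain of a. *)
Definition ptrans (n : nat) : Type := {ffun 'I_n -> option 'I_n}.

HB.instance Definition _ (n : nat) :=
  Finite.copy (ptrans n) {ffun 'I_n -> option 'I_n}.

Definition ptrans_fun (n : nat) (a : ptrans n) : 'I_n -> option 'I_n :=
  fun_of_fin a.
Coercion ptrans_fun : ptrans >-> Funclass.

(* Left-to-right composition: x (a b) = (x a) b. *)
Definition ptrans_comp (n : nat) (a b : ptrans n) : ptrans n :=
  [ffun x => obind b (a x)].

Lemma ptrans_compE n (a b : ptrans n) x : ptrans_comp a b x = obind b (a x).
Proof. by rewrite /ptrans_comp /ptrans_fun ffunE. Qed.

Lemma ptrans_compA n : associative (@ptrans_comp n).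
Proof.
move=> a b c; apply/ffunP => x.
by rewrite -!/(ptrans_fun _ _) !ptrans_compE; case: (a x) => //= y;
   rewrite ptrans_compE.
Qed.

HB.instance Definition _ (n : nat) :=
  isSemigroup.Build (ptrans n) (@ptrans_compA n).

Definition contraction (n : nat) : pred (ptrans n) := fun a =>
  [forall x, forall y, forall u, forall v,
    (a x == Some u) ==> (a y == Some v) ==> (`|u - v| <= `|x - y|)%N].

Definition order_preserving (n : nat) : pred (ptrans n) := fun a =>
  [forall x, forall y, forall u, forall v,
    (a x == Some u) ==> (a y == Some v) ==> (x <= y)%N ==> (u <= v)%N].

Definition order_reversing (n : nat) : pred (ptrans n) := fun a =>
  [forall x, forall y, forall u, forall v,
    (a x == Some u) ==> (a y == Some v) ==> (x <= y)%N ==> (v <= u)%N].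

Definition CP_pred (n : nat) : pred (ptrans n) := fun a => contraction a.
Definition ORCP_pred (n : nat) : pred (ptrans n) := fun a =>
  contraction a && (order_preserving a || order_reversing a).
Definition OCP_pred (n : nat) : pred (ptrans n) := fun a =>
  contraction a && order_preserving a.

Lemma forall4P (n : nat) (a : ptrans n) (P : 'I_n -> 'I_n -> 'I_n -> 'I_n -> bool) :
  reflect (forall x y u v, a x = Some u -> a y = Some v -> P x y u v)
    [forall x, forall y, forall u, forall v,
       (a x == Some u) ==> (a y == Some v) ==> P x y u v].
Proof.
apply: (iffP forallP) => [H x y u v axu ayv | H x].
  by move: (H x) => /forallP/(_ y)/forallP/(_ u)/forallP/(_ v); rewrite axu ayv !eqxx.
apply/forallP => y; apply/forallP => u; apply/forallP => v.
by apply/implyP => /eqP axu; apply/implyP => /eqP ayv; apply: H.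
Qed.

Lemma contractionP (n : nat) (a : ptrans n) :
  reflect (forall x y u v, a x = Some u -> a y = Some v -> (`|u - v| <= `|x - y|)%N)
    (contraction a).
Proof. exact: (forall4P a (fun x y u v => `|u - v| <= `|x - y|)%N). Qed.

Lemma order_preservingP (n : nat) (a : ptrans n) :
  reflect (forall x y u v, a x = Some u -> a y = Some v -> (x <= y)%N -> (u <= v)%N)
    (order_preserving a).
Proof.
apply: (iffP (forall4P a (fun x y u v => (x <= y)%N ==> (u <= v)%N))) => H x y u v.
  by move=> au av; apply/implyP/H.
by move=> au av; apply/implyP; apply: H.
Qed.

Lemma order_reversingP (n : nat) (a : ptrans n) :
  reflect (forall x y u v, a x = Some u -> a y = Some v -> (x <= y)%N -> (v <= u)%N)
    (order_reversing a).
Proof.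
apply: (iffP (forall4P a (fun x y u v => (x <= y)%N ==> (v <= u)%N))) => H x y u v.
  by move=> au av; apply/implyP/H.
by move=> au av; apply/implyP; apply: H.
Qed.

Lemma ptrans_comp_Some (n : nat) (a b : ptrans n) x u :
  (a * b) x = Some u -> exists2 z, a x = Some z & b z = Some u.
Proof. by rewrite [LHS]ptrans_compE; case: (a x) => //= z; exists z. Qed.

Lemma contractionM (n : nat) (a b : ptrans n) :
  contraction a -> contraction b -> contraction (a * b).
Proof.
move=> /contractionP Ha /contractionP Hb; apply/contractionP => x y u v.
move=> /ptrans_comp_Some[z az bz] /ptrans_comp_Some[t at_ bt].
exact: leq_trans (Hb _ _ _ _ bz bt) (Ha _ _ _ _ az at_).
Qed.

Lemma monotoneM (n : nat) (a b : ptrans n) :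
  [/\ order_preserving a -> order_preserving b -> order_preserving (a * b),
      order_preserving a -> order_reversing b -> order_reversing (a * b),
      order_reversing a -> order_preserving b -> order_reversing (a * b)
    & order_reversing a -> order_reversing b -> order_preserving (a * b)].
Proof.
split.
- move=> /order_preservingP Ha /order_preservingP Hb; apply/order_preservingP => x y u v.
  move=> /ptrans_comp_Some[z az bz] /ptrans_comp_Some[t at_ bt] xy.
  exact: Hb bz bt (Ha _ _ _ _ az at_ xy).
- move=> /order_preservingP Ha /order_reversingP Hb; apply/order_reversingP => x y u v.
  move=> /ptrans_comp_Some[z az bz] /ptrans_comp_Some[t at_ bt] xy.
  exact: Hb bz bt (Ha _ _ _ _ az at_ xy).
- move=> /order_reversingP Ha /order_preservingP Hb; apply/order_reversingP => x y u v.
  move=> /ptrans_comp_Some[z az bz] /ptrans_comp_Some[t at_ bt] xy.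
  exact: Hb bt bz (Ha _ _ _ _ az at_ xy).
- move=> /order_reversingP Ha /order_reversingP Hb; apply/order_preservingP => x y u v.
  move=> /ptrans_comp_Some[z az bz] /ptrans_comp_Some[t at_ bt] xy.
  exact: Hb bt bz (Ha _ _ _ _ az at_ xy).
Qed.

Lemma CP_mulg_closed (n : nat) : mulg_closed (@CP_pred n).
Proof. by move=> a b; apply: contractionM. Qed.

Lemma ORCP_mulg_closed (n : nat) : mulg_closed (@ORCP_pred n).
Proof.
move=> a b /andP[ca oa] /andP[cb ob]; apply/andP; split; first exact: contractionM.
have [pp pr rp rr] := monotoneM a b; apply/orP.
by case/orP: oa => oa; case/orP: ob => ob;
   [left; apply: pp | right; apply: pr | right; apply: rp | left; apply: rr].
Qed.

Lemma OCP_mulg_closed (n : nat) : mulg_closed (@OCP_pred n).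
Proof.
move=> a b /andP[ca oa] /andP[cb ob]; apply/andP; split; first exact: contractionM.
by have [pp _ _ _] := monotoneM a b; apply: pp.
Qed.

Record CP (n : nat) := MkCP { CP_val :> ptrans n; _ : CP_pred CP_val }.
HB.instance Definition _ (n : nat) := [isSub for @CP_val n].
HB.instance Definition _ (n : nat) := [Finite of CP n by <:].
HB.instance Definition _ (n : nat) :=
  SubChoice_isSubSemigroup.Build (ptrans n) (@CP_pred n) (CP n) (@CP_mulg_closed n).

Record ORCP (n : nat) := MkORCP { ORCP_val :> ptrans n; _ : ORCP_pred ORCP_val }.
HB.instance Definition _ (n : nat) := [isSub for @ORCP_val n].
HB.instance Definition _ (n : nat) := [Finite of ORCP n by <:].
HB.instance Definition _ (n : nat) :=
  SubChoice_isSubSemigroup.Build (ptrans n) (@ORCP_pred n) (ORCP n)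
    (@ORCP_mulg_closed n).

Record OCP (n : nat) := MkOCP { OCP_val :> ptrans n; _ : OCP_pred OCP_val }.
HB.instance Definition _ (n : nat) := [isSub for @OCP_val n].
HB.instance Definition _ (n : nat) := [Finite of OCP n by <:].
HB.instance Definition _ (n : nat) :=
  SubChoice_isSubSemigroup.Build (ptrans n) (@OCP_pred n) (OCP n)
    (@OCP_mulg_closed n).

(* Main.v *)
Require Import Defs.
From mathcomp Require Import all_boot.
From mathcomp Require Import zify.

(** Each of the three semigroups contains all order preserving partial
    contractions, in particular the partial identities and the maps with a
    one-point domain. These force [a L* b] to mean that [a] and [b] have the same
    image, and [a R* b] to mean that they have the same kernel (and domain). Both
    relations therefore preserve the rank, so the elements of rank at most [k] form
    a *-ideal and J*-related elements have equal ranks. Conversely, for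
    [A] of size [k] let [c_A] be the order isomorphism from [A] onto the initial
    segment of size [k]; it is a contraction because it only closes gaps. If [a] and
    [b] have equal ranks and images [A] and [B], then
    [a L* id_A R* c_A L* c_B R* id_B L* b]. *)

Set Implicit Arguments.
Unset Strict Implicit.
Unset Printing Implicit Defensive.

Local Open Scope group_scope.

(** * Star relations and star ideals in an arbitrary semigroup *)

Section StarTheory.
Variable S : semigroupType.
Implicit Types a b : S.

Lemma Lstar_sym a b : Lstar a b -> Lstar b a.
Proof. by move=> ab x y x1 y1; apply: iff_sym; apply: ab. Qed.

Lemma Rstar_sym a b : Rstar a b -> Rstar b a.
Proof. by move=> ab x y x1 y1; apply: iff_sym; apply: ab. Qed.

Lemma Lstar_Jstar a b : Lstar a b -> Jstar a b.
Proof.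
move=> ab x; split=> Jx I sI Ic; apply: Jx => //.
  by case: sI => -[_ IL] _; apply: IL Ic (Lstar_sym ab).
by case: sI => -[_ IL] _; apply: IL Ic ab.
Qed.

Lemma Rstar_Jstar a b : Rstar a b -> Jstar a b.
Proof.
move=> ab x; split=> Jx I sI Ic; apply: Jx => //.
  by case: sI => _ [_ IR]; apply: IR Ic (Rstar_sym ab).
by case: sI => _ [_ IR]; apply: IR Ic ab.
Qed.

(** Star ideals are closed under L* and R*, so [Jstar] is an equivalence containing both, and
    [Dstar] is the least one. *)
Lemma Dstar_Jstar a b : Dstar a b -> Jstar a b.
Proof.
apply; [split | exact: Lstar_Jstar | exact: Rstar_Jstar].
- by move=> x y.
- by move=> x y z xy yz t; rewrite xy yz.
- by move=> x y xy t; rewrite xy.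
Qed.

Lemma Jstar_star_ideal (I : S -> Prop) a b :
  star_ideal I -> Jstar a b -> I b -> I a.
Proof. by move=> sI ab Ib; apply: (proj1 (ab a)) => // K _. Qed.

End StarTheory.

(** * Images and ranks of partial maps *)

Section PartialTransformations.
Variable n : nat.
Implicit Types (a b : ptrans n) (A : {set 'I_n}) (x y u : 'I_n).

Definition pimage a : {set option 'I_n} := [set a x | x : 'I_n] :\ None.

Definition prank a := #|pimage a|.

Lemma pimageP a (o : option 'I_n) :
  reflect (o <> None /\ exists x, a x = o) (o \in pimage a).
Proof.
rewrite in_setD1; apply: (iffP andP) => -[/eqP oN].
  by case/imsetP=> x _ ox; split=> //; exists x.
by case=> x ox; split=> //; rewrite -ox; exact: imset_f.
Qed.

Lemma ptrans_ext a b : (forall x, a x = b x) -> a = b.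
Proof. by move=> ab; apply/ffunP. Qed.

Lemma ptrans_mulE a b x : ptrans_fun (a * b) x = obind b (a x).
Proof. exact: ptrans_compE. Qed.

Lemma pimageM a b : pimage (a * b) \subset pimage b.
Proof.
apply/subsetP => o /pimageP[oN [x]]; rewrite ptrans_mulE.
by case: (a x) => [z|] /= E; [apply/pimageP; split=> //; exists z | case: oN].
Qed.

(** The hypotheses make [b] factor through [a], with undefined values staying undefined; the factor
    then sends the image of [a] to a set covering the image of [b]. *)
Lemma prank_factor a b :
    (forall x, a x = None -> b x = None) ->
    (forall x y, a x = a y -> b x = b y) ->
  prank b <= prank a.
Proof.
move=> abN abE.
(* [h] reads [b] off any preimage under [a]; the default is met only outside the range of [a]. *)
pose h o := if [pick x | a x == o] is Some x then b x else None.
have hE x : h (a x) = b x.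
  rewrite /h; case: pickP => [y /eqP/abE //|/(_ x)]; by rewrite eqxx.
apply: leq_trans (leq_imset_card h _); apply/subset_leq_card/subsetP => o.
case/pimageP=> oN [x E]; apply/imsetP; exists (a x); last by rewrite hE.
by apply/pimageP; split; [move=> /abN; rewrite E | exists x].
Qed.

Lemma prankMl a b : prank (a * b) <= prank b.
Proof. exact/subset_leq_card/pimageM. Qed.

Lemma prankMr a b : prank (a * b) <= prank a.
Proof.
by apply: prank_factor => [x|x y] E; rewrite ?ptrans_mulE E.
Qed.

(** * Partial identities and one-point maps *)

Definition pid A : ptrans n := [ffun x => if x \in A then Some x else None].

Lemma pidE A x : pid A x = if x \in A then Some x else None.
Proof. by rewrite /pid /ptrans_fun ffunE. Qed.

Lemma pid_OCP A : OCP_pred (pid A).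
Proof.
apply/andP; split; [apply/contractionP | apply/order_preservingP] => x y u v;
  by rewrite !pidE; case: ifP => // _ [<-]; case: ifP => // _ [<-].
Qed.

Definition ppoint x u : ptrans n := [ffun z => if z == x then Some u else None].

Lemma ppointE x u z : ppoint x u z = if z == x then Some u else None.
Proof. by rewrite /ppoint /ptrans_fun ffunE. Qed.

Lemma ppoint_OCP x u : OCP_pred (ppoint x u).
Proof.
apply/andP; split; [apply/contractionP | apply/order_preservingP] => z t v w;
  rewrite !ppointE; case: ifP => // _ [<-]; case: ifP => // _ [<-] //.
lia.
Qed.

Lemma ppointM x u a z : ptrans_fun (ppoint x u * a) z = if z == x then a u else None.
Proof. by rewrite ptrans_mulE ppointE; case: ifP. Qed.

(** * Closing the gaps of a subset by counting smaller elements *)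

Definition below A (m : nat) : {set 'I_n} := [set y in A | y < m].

Lemma card_below_lt A x m : x \in A -> x < m -> #|below A x| < #|below A m|.
Proof.
move=> Ax xm; apply: proper_card; apply/properP; split.
  by apply/subsetP => y; rewrite !inE => /andP[-> /ltn_trans->].
by exists x; rewrite !inE Ax ?ltnn.
Qed.

Lemma card_below_lt_set A x : x \in A -> #|below A x| < #|A|.
Proof.
move=> Ax; apply: proper_card; apply/properP; split.
  by apply/subsetP => y; rewrite !inE => /andP[].
by exists x; rewrite // !inE ltnn andbF.
Qed.

(** At most one point of the chain has value [m]. Iterating this bounds the growth of the count by
    the distance, which makes [compress] a contraction. *)
Lemma card_belowS A m : #|below A m.+1| <= #|below A m|.+1.
Proof.
have le1: #|[set y : 'I_n | y == m :> nat]| <= 1.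
  by apply/card_le1_eqP => y z; rewrite !inE => /eqP ym /eqP zm;
     apply: val_inj; rewrite /= ym zm.
rewrite -[leqRHS]addn1; apply: leq_trans (leq_add (leqnn _) le1).
apply: leq_trans (leq_of_leqif (leq_card_setU _ _)); apply/subset_leq_card/subsetP => y.
by rewrite !inE ltnS leq_eqVlt => /andP[-> /orP[]->]; rewrite ?orbT.
Qed.

Lemma card_belowD A m k : #|below A (m + k)| <= #|below A m| + k.
Proof.
elim: k => [|k IHk]; first by rewrite !addn0.
by rewrite !addnS (leq_trans (card_belowS _ _)).
Qed.

(* [insub] is defined at the elements of [A] because fewer than [#|A| <= n]
   elements of [A] lie below any of them. *)
Definition compress A : ptrans n :=
  [ffun x => if x \in A then insub #|below A x| else None].

Lemma compressE A x :
  compress A x = if x \in A then insub #|below A x| else None.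
Proof. by rewrite /compress /ptrans_fun ffunE. Qed.

Lemma compress_Some A x :
  x \in A -> exists2 u, compress A x = Some u & u = #|below A x| :> nat.
Proof.
move=> Ax; rewrite compressE Ax.
have lt_n : #|below A x| < n.
  by apply: leq_trans (card_below_lt_set Ax) _; rewrite -[n in _ <= n]card_ord max_card.
by exists (Ordinal lt_n) => //; rewrite insubT.
Qed.

Lemma compress_val A x u :
  compress A x = Some u -> x \in A /\ u = #|below A x| :> nat.
Proof.
move=> E; have Ax : x \in A by move: E; rewrite compressE; case: ifP.
by have [v] := compress_Some Ax; rewrite E => -[<-].
Qed.

Lemma compress_inj A x y : x \in A -> compress A x = compress A y -> x = y.
Proof.
move=> Ax; have [u -> uE] := compress_Some Ax => /esym/compress_val[Ay].
rewrite {}uE => E; apply: val_inj => /=.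
case: (ltngtP x y) => // lt; first by have := card_below_lt Ax lt; rewrite E ltnn.
by have := card_below_lt Ay lt; rewrite E ltnn.
Qed.

Lemma compress_le A x y u v :
    compress A x = Some u -> compress A y = Some v -> x <= y ->
  u <= v <= u + (y - x).
Proof.
move=> /compress_val[Ax ->] /compress_val[Ay ->] le_xy.
have := card_belowD A x (y - x); rewrite subnKC // => ->; rewrite andbT.
move: le_xy; rewrite leq_eqVlt => /orP[/eqP/val_inj->//|].
by move/(card_below_lt Ax)/ltnW.
Qed.

Lemma compress_OCP A : OCP_pred (compress A).
Proof.
apply/andP; split; [apply/contractionP | apply/order_preservingP] => x y u v xu yv.
  case: (leqP x y) => [|/ltnW] le_xy.
    by have := compress_le xu yv le_xy; lia.
  by have := compress_le yv xu le_xy; lia.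
by case/(compress_le xu yv)/andP.
Qed.

(** The image depends only on the size of [A]. One inclusion is clear; equality follows by counting,
    as [compress A] is injective on [A]. *)
Lemma pimage_compress A :
  pimage (compress A) = [set Some u | u : 'I_n & u < #|A|].
Proof.
apply/eqP; rewrite eqEcard; apply/andP; split.
  apply/subsetP => -[u|] /pimageP[// _ [x]].
  case/compress_val=> Ax uE; apply/imset_f; rewrite inE uE.
  exact: card_below_lt_set.
have le_An : #|A| <= n by rewrite -[n in _ <= n]card_ord max_card.
rewrite card_imset; last by move=> ? ? [].
apply: (@leq_trans #|A|).
  have widen_inj : injective (widen_ord le_An).
    by move=> i j /(congr1 val) /= /val_inj.
  rewrite -[leqRHS]card_ord -(card_imset _ widen_inj).
  apply/subset_leq_card/subsetP => u; rewrite inE => uA.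
  by apply/imsetP; exists (Ordinal uA) => //; apply: val_inj.
rewrite -(card_in_imset (f := compress A) (D := A)) => [|x y Ax _]; last first.
  exact: compress_inj.
apply/subset_leq_card/subsetP => o /imsetP[x Ax ->]; apply/pimageP.
by split; [have [u ->] := compress_Some Ax | exists x].
Qed.

(** * Images as subsets of the chain, and right multiplication *)

Definition image_set a : {set 'I_n} := [set u | Some u \in pimage a].

Lemma pimage_pid A : pimage (pid A) = [set Some u | u in A].
Proof.
apply/setP => o; apply/pimageP/imsetP => [[oN [x]]|[u Au ->]].
  by rewrite pidE; case: ifP => Ax E; [exists x | case: oN].
by split=> //; exists u; rewrite pidE Au.
Qed.

Lemma pimage_image_set a : [set Some u | u in image_set a] = pimage a.
Proof.
apply/setP => o; apply/imsetP/idP => [[u]|ao]; first by rewrite inE => ? ->.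
by case: o ao => [u ao|/pimageP[]//]; exists u => //; rewrite inE.
Qed.

Lemma card_image_set a : #|image_set a| = prank a.
Proof. by rewrite /prank -pimage_image_set card_imset // => ? ? []. Qed.

(** Turns an inclusion of images into an equation that L* can transfer. *)
Lemma mul_pid_image a A : pimage a \subset [set Some u | u in A] <-> a * pid A = a.
Proof.
split=> [/subsetP aA | <-]; last by rewrite -pimage_pid pimageM.
apply: ptrans_ext => x; rewrite ptrans_mulE.
case E: (a x) => [u|] //=; rewrite pidE.
have: Some u \in pimage a by apply/pimageP; split=> //; exists x.
by case/aA/imsetP => v Av [->]; rewrite Av.
Qed.

(** The equation [a * c = a * d] says that [c] and [d] agree on the image of [a]. *)
Lemma mul_eq_on_image a b c d :
  pimage b \subset pimage a -> a * c = a * d -> b * c = b * d.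
Proof.
move=> /subsetP ba E; apply: ptrans_ext => x.
rewrite !ptrans_mulE; case Eb: (b x) => [u|] //=.
have /ba/pimageP[_ [y Ey]]: Some u \in pimage b.
  by apply/pimageP; split=> //; exists x.
have := congr1 (fun e : ptrans n => e y) E.
by rewrite /= !ptrans_mulE Ey.
Qed.

End PartialTransformations.

(** * Semigroups of partial maps containing all order preserving contractions *)

Section RichSubsemigroup.
Variables (n : nat) (S : semigroupType) (f : S -> ptrans n).
Hypotheses (f_inj : injective f) (fM : {morph f : a b / a * b >-> a * b})
  (f_OCP : forall p : ptrans n, OCP_pred p -> exists s, f s = p).
Implicit Types a b s : S.

(** The full identity map lies in [S], so no identity is adjoined in S^1. *)
Lemma rich_has_identity : has_identity S.
Proof.
have [e eE] := f_OCP (pid_OCP [set: 'I_n]); exists e => s.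
split; apply: f_inj; rewrite fM eE; last first.
  apply/mul_pid_image/subsetP => -[u|/pimageP[]//] _; exact/imset_f/in_setT.
by apply: ptrans_ext => x; rewrite ptrans_mulE pidE inE.
Qed.

Lemma rich_in_S1 (x : option S) : in_S1 x -> exists s, x = Some s.
Proof. by case: x => [s _|/(_ rich_has_identity)//]; exists s. Qed.

(** Forward, the partial identity [i] on the image of [a] satisfies [a * i = a * e]; transferring
    this to [b] confines its image. *)
Lemma Lstar_pimage a b : Lstar a b <-> pimage (f a) = pimage (f b).
Proof.
split=> [ab | Eab _ _ /rich_in_S1[x ->] /rich_in_S1[y ->] /=]; last first.
  by split=> /(congr1 f); rewrite !fM => E; apply: f_inj; rewrite !fM;
     apply: mul_eq_on_image E; rewrite Eab.
wlog suff: a b ab / pimage (f b) \subset pimage (f a).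
  move=> H; apply/eqP; rewrite eqEsubset !H //; exact: Lstar_sym.
have [e eE] := f_OCP (pid_OCP [set: 'I_n]).
have [i iE] := f_OCP (pid_OCP (image_set (f a))).
have mul_e c : c * e = c.
  apply: f_inj; rewrite fM eE; apply/mul_pid_image/subsetP => -[u|/pimageP[]//] _.
  exact/imset_f/in_setT.
have [+ _] := ab (Some i) (Some e) I I; rewrite /= !mul_e => H.
rewrite -(pimage_image_set (f a)); apply/mul_pid_image.
rewrite -iE -fM H //; apply: f_inj; rewrite fM iE.
by apply/mul_pid_image; rewrite pimage_image_set.
Qed.

(** Forward, left multiplication by one-point maps evaluates [a] and [b] at chosen points. Backward,
    [s * c = t * c] only compares values of [c], or their absence, pointwise. *)
Lemma Rstar_kernel a b :
  Rstar a b <->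
  (forall x, f a x = None <-> f b x = None) /\
  (forall x y, f a x = f a y <-> f b x = f b y).
Proof.
split=> [ab | [abN abE] _ _ /rich_in_S1[s ->] /rich_in_S1[t ->] /=]; last first.
  have H c d : (forall x, f c x = None -> f d x = None) ->
      (forall x y, f c x = f c y -> f d x = f d y) -> s * c = t * c -> s * d = t * d.
    move=> cdN cdE /(congr1 f); rewrite !fM => E; apply: f_inj; rewrite !fM.
    apply: ptrans_ext => x; have := congr1 (fun e : ptrans n => e x) E.
    rewrite /= !ptrans_mulE.
    case: (f s x) => [u|]; case: (f t x) => [v|] //=; first exact: cdE.
      exact: cdN.
    by move/esym/cdN.
  split; apply: H => [x|x y]; by [case: (abN x) | case: (abE x y)].
wlog suff: a b ab / (forall x, f a x = None -> f b x = None) /\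
                    (forall x y, f a x = f a y -> f b x = f b y).
  move=> H; have [N1 E1] := H _ _ ab; have [N2 E2] := H _ _ (Rstar_sym ab).
  by split=> [x|x y]; split; auto.
split=> [x|x y] E.
  (* Comparison with the empty map detects that [x] is outside the domain. *)
  have [s sE] := f_OCP (ppoint_OCP x x); have [t tE] := f_OCP (pid_OCP set0).
  have [+ _] := ab (Some s) (Some t) I I; rewrite /= => H.
  have /(congr1 (fun c => f c x)) : s * b = t * b.
    apply: H; apply: f_inj; rewrite !fM sE tE; apply: ptrans_ext => z.
    by rewrite ppointM ptrans_mulE pidE inE E if_same.
  by rewrite !fM sE tE ppointM eqxx ptrans_mulE pidE inE.
(* Both maps have domain [x] alone, so the products compare the values at [x] and [y]. *)
have [s sE] := f_OCP (ppoint_OCP x x); have [t tE] := f_OCP (ppoint_OCP x y).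
have [+ _] := ab (Some s) (Some t) I I; rewrite /= => H.
have /(congr1 (fun c => f c x)) : s * b = t * b.
  by apply: H; apply: f_inj; rewrite !fM sE tE; apply: ptrans_ext => z; rewrite !ppointM E.
by rewrite !fM sE tE !ppointM eqxx.
Qed.

Lemma star_ideal_prank k : star_ideal (fun s => prank (f s) <= k).
Proof.
split; split=> [s a | a b] le_k.
- by rewrite fM (leq_trans (prankMl _ _)).
- by move/Lstar_pimage; rewrite /prank => <-.
- by rewrite fM (leq_trans (prankMr _ _)).
- case/Rstar_kernel=> abN abE; apply: leq_trans le_k.
  by apply: prank_factor => [x|x y]; [case: (abN x) | case: (abE x y)].
Qed.

Lemma Jstar_prank a b : Jstar a b -> prank (f a) = prank (f b).
Proof.
move=> ab; apply/eqP; rewrite eqn_leq.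
rewrite (Jstar_star_ideal (star_ideal_prank _) ab (leqnn _)).
by apply: (Jstar_star_ideal (star_ideal_prank _) _ (leqnn _)) => x; rewrite ab.
Qed.

Lemma prank_Dstar a b : prank (f a) = prank (f b) -> Dstar a b.
Proof.
move=> Eab E [_ trE symE] LE RE.
(* The half-chain from [c] through the partial identity on its image to the compression of that
   image. *)
have reach c : exists2 d, E c d & f d = compress (image_set (f c)).
  have [i iE] := f_OCP (pid_OCP (image_set (f c))).
  have [d dE] := f_OCP (compress_OCP (image_set (f c))).
  exists d => //; apply: (trE _ i).
    by apply/LE/Lstar_pimage; rewrite iE pimage_pid pimage_image_set.
  apply/RE/Rstar_kernel; rewrite iE dE; set A := image_set _.
  (* Both maps have domain [A] and are injective there, hence have the same kernel. *)
  have idc x : pid A x = None <-> compress A x = None.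
    rewrite pidE; case: ifP => Ax; last by rewrite compressE Ax.
    by have [u ->] := compress_Some Ax.
  split=> // x y; case Ax: (x \in A); last first.
    have Nx : pid A x = None by rewrite pidE Ax.
    rewrite Nx (proj1 (idc x) Nx).
    by split=> /esym/idc/esym.
  split=> [|/compress_inj-> //].
  by rewrite !pidE Ax; case: ifP => // _ [->].
have [c ac cE] := reach a; have [d bd dE] := reach b.
(* Equal ranks give both compressions the same initial segment as image. *)
apply: trE ac (trE _ d _ _ (symE _ _ bd)); apply/LE/Lstar_pimage.
by rewrite cE dE !pimage_compress !card_image_set Eab.
Qed.

Lemma Dstar_iff_Jstar a b : Dstar a b <-> Jstar a b.
Proof. by split=> [/Dstar_Jstar // | /Jstar_prank/prank_Dstar]. Qed.

End RichSubsemigroup.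

Theorem corollary2p4 (n : nat) (hn : 1 <= n) :
  [/\ forall a b : CP n, Dstar a b <-> Jstar a b,
      forall a b : ORCP n, Dstar a b <-> Jstar a b
    & forall a b : OCP n, Dstar a b <-> Jstar a b].
Proof.
(* Each subtype embeds by its value map; it remains to lift every order preserving contraction into
   it. *)
split; apply: (Dstar_iff_Jstar val_inj) => // p /andP[cp op].
- by exists (@MkCP n p cp).
- have pP : ORCP_pred p by rewrite /ORCP_pred cp op.
  by exists (MkORCP pP).
- have pP : OCP_pred p by rewrite /OCP_pred cp op.
  by exists (MkOCP pP).
Qed.
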